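(* Consider the relay system described in the context under static policies with parameter $\alpha$, and suppose that the average system delay $\overline{D_R}$ at node R is an increasing convex function of $\alpha$. Let $\alpha^{D}$ denote the value of $\alpha$ minimizing the average transmission delay $\tau=(\overline{q_d}+1)/\lambda_S$. The non-cooperation policy is delay-optimal, i.e. $\alpha^{D}=0$, if and only if $$\overline{D_R}|_{\alpha\to 0}>\frac{1}{p^{det}_S},$$ where $\overline{D_R}|_{\alpha\to 0}$ is the average system delay at node R when $\alpha\to0$.
   Context: Model. Parameters: $p^{det}_S,p^{det}_R\in(0,1)$; integers $b_{\max}\ge 1$, $K$, $N$ with $b_{\max}\le K$ and $N\ge 2K$; a random variable $\Gamma$ on $\{0,1,\dots,b_{\max}\}$ with $\gamma_m=\Pr\{\Gamma=m\}$, $\gamma_{b_{\max}}>0$, and mean $E(\Gamma)>0$. A relay R has an infinite data buffer $Q_d$ and an energy buffer $Q_e$ of size $N$. Time is slotted, each slot (the time unit) consisting of two equal subslots. At the beginning of a slot the state is $s=(q_d,q_e)$, with $q_d\in\{0,1,2,\dots\}$ the number of data packets in $Q_d$ and $q_e\in\{0,\dots,N\}$ the number of energy units in $Q_e$. With probability $\alpha_s$ node R chooses the data decoding (DD) mode, and otherwise the energy harvesting (EH) mode. First subslot: the source, which always has a packet, transmits, and the destination detects the packet with probability $p^{det}_S$. In DD mode, if the destination does not detect the packet (probability $1-p^{det}_S$), the packet is added to $Q_d$ at the end of the first subslot; $q_e$ does not change. In EH mode, $q_d$ does not change and $q_e$ becomes $\min(N,q_e+\Gamma)$; units in excess of $N$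 are lost (blocked). Second subslot (using the values after the first subslot): if $Q_d$ contains at least one packet and $q_e\ge K$, node R is called active; it transmits the head-of-line packet (first-come first-served), $q_e$ decreases by $K$, and with probability $p^{det}_R$ the transmission succeeds and the packet leaves $Q_d$ at the end of the slot (otherwise it stays at the head of line). If R is not active, nothing changes. All random choices (mode choices, detections, harvested amounts) are independent. A static policy has $\alpha_s=\alpha\in[0,1]$ for all states $s$. The non-cooperation policy is the static policy with $\alpha=0$. Long-run quantities. $p^a_R$ is the long-run fraction of slots in which R is active; the source throughput is $\lambda_S=p^{det}_S+p^a_R p^{det}_R$. The data arrival rate to $Q_d$ is $\lambda_{id}=\alpha(1-p^{det}_S)$ and the departure rate is $\lambda_{od}=p^a_Rp^{det}_R$; $Q_d$ is stable when they are equal. $\overline{q_d}$ is the time-average number of packets in $Q_d$; the average transmission delay is $\tau=(\overline{q_d}+1)/\lambda_S$ (infinite if $\overline{q_d}$ is infinite, in particular if $Q_d$ is unstable). $\overline{D_R}$ is the average time (in slots) a packet spends at R (queueing delay plus transmission time) from its arrival to $Q_d$ until its successful transmission; by Little's law $\overline{q_d}=\lambda_{id}\overline{D_R}$.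
   Formalization: The equivalence is stated when the limit of D_R as α→0 differs from 1/p_S^det; when they are equal, the printed ''only if'' fails (α=0 is still optimal, though the strict inequality does not hold), and it is shown instead that α=0 minimizes τ. *)

(* Defs.v *)
From HB Require Import structures.
From mathcomp Require Import all_boot all_order all_algebra.
From mathcomp Require Import all_classical all_reals all_analysis.
Set Implicit Arguments.
Unset Strict Implicit.
Unset Printing Implicit Defensive.
Import Order.TTheory GRing.Theory Num.Theory.
Import numFieldNormedType.Exports.
Local Open Scope classical_set_scope.
Local Open Scope ring_scope.

(* The random choices of one slot. [harvest] and [detR] are drawn in every
   slot, but are used only in EH mode and when R is active, respectively. *)
Definition draw (bmax : nat) : Type := (bool * bool * 'I_bmax.+1 * bool)%type.

Section Draw.
Variable bmax : nat.
Implicit Type x : draw bmax.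
Definition dd_mode x : bool := x.1.1.1.
Definition detS x : bool := x.1.1.2.
Definition harvest x : 'I_bmax.+1 := x.1.2.
Definition detR x : bool := x.2.
End Draw.

Definition bern (R : realType) (p : R) (b : bool) : R := if b then p else 1 - p.

Definition draw_law (R : realType) (bmax : nat) (alpha pS pR : R)
    (gamma : 'I_bmax.+1 -> R) (x : draw bmax) : R :=
  bern alpha (dd_mode x) * bern pS (detS x) * gamma (harvest x) *
  bern pR (detR x).

(* X 0, X 1, ... are i.i.d. with the law above; as draws are discrete, this is
   the product formula for the joint law of every initial segment. *)
Definition iid_draws (R : realType) (d : measure_display)
    (T : measurableType d) (P : probability T R) (bmax : nat)
    (alpha pS pR : R) (gamma : 'I_bmax.+1 -> R)
    (X : nat -> T -> draw bmax) : Prop :=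
  (forall n x, measurable [set w | X n w = x]) /\
  forall (n : nat) (x : 'I_n -> draw bmax),
    P [set w | forall i : 'I_n, X i w = x i] =
    (\prod_(i < n) draw_law alpha pS pR gamma (x i))%:E.

(* A state is a pair (q_d, q_e). *)
Definition qstate : Type := (nat * nat)%type.

Section Dynamics.
Variables (bmax K N : nat).
Implicit Types (s : qstate) (x : draw bmax) (xs : nat -> draw bmax).

Definition arrives x : bool := dd_mode x && ~~ detS x.

Definition midslot s x : qstate :=
  if dd_mode x then ((s.1 + arrives x)%N, s.2)
  else (s.1, minn N (s.2 + harvest x)).

Definition active s x : bool :=
  (0 < (midslot s x).1)%N && (K <= (midslot s x).2)%N.

Definition departs s x : bool := active s x && detR x.

Definition next_state s x : qstate :=
  let m := midslot s x in
  if active s x then ((m.1 - departs s x)%N, (m.2 - K)%N) else m.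

Fixpoint state s0 xs (n : nat) : qstate :=
  if n is n'.+1 then next_state (state s0 xs n') (xs n') else s0.

Definition active_at s0 xs n : bool := active (state s0 xs n) (xs n).

Definition departs_at s0 xs n : bool := departs (state s0 xs n) (xs n).

(* Number of packets in Q_d just after the first subslot of slot n. *)
Definition qd_mid s0 xs n : nat := (midslot (state s0 xs n) (xs n)).1.

(* Time integral over slot n of the number of packets in Q_d: the slot consists
   of two subslots of length 1/2; arrivals occur between the two, departures
   at the end of the second. *)
Definition qd_slot (R : realType) s0 xs n : R :=
  ((state s0 xs n).1%:R + (qd_mid s0 xs n)%:R) / 2.

(* Time spent at R by the packet that arrives in slot n. By the FCFS rule it
   leaves at the end of the first slot m such that the number of departures in
   slots n..m reaches the number of packets present just after its arrival
   (itself included); having arrived at the middle of slot n, it has then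
   spent m - n + 1/2 slots at R. The value is +oo if it never leaves. *)
Definition sojourn (R : realType) s0 xs n : \bar R :=
  ereal_inf [set ((m - n)%:R + 1 / 2)%:E | m in
    [set m | (n <= m)%N /\
             (qd_mid s0 xs n <= \sum_(n <= i < m.+1) departs_at s0 xs i)%N]].

(* Average of the sojourn times of the packets that arrive in slots < t. *)
Definition mean_sojourn (R : realType) s0 xs (t : nat) : \bar R :=
  ((\sum_(0 <= n < t | arrives (xs n)) sojourn R s0 xs n) *
   (((\sum_(0 <= n < t) arrives (xs n))%N%:R)^-1)%:E)%E.

End Dynamics.

Definition time_avg (R : realType) (f : nat -> R) (t : nat) : \bar R :=
  ((\sum_(0 <= n < t) f n) / t%:R)%:E.

Section LongRun.
Context (R : realType) (d : measure_display) (T : measurableType d).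
Variables (P : probability T R) (bmax K N : nat) (s0 : qstate).
Variable X : nat -> T -> draw bmax.

Definition sample_path (w : T) : nat -> draw bmax := fun n => X n w.

Definition is_active_fraction (pa : R) : Prop :=
  {ae P, forall w,
    time_avg (fun n => (active_at K N s0 (sample_path w) n)%:R) t @[t --> \oo]
      --> pa%:E}.

Definition is_mean_queue (qd : \bar R) : Prop :=
  {ae P, forall w,
    time_avg (qd_slot K N R s0 (sample_path w)) t @[t --> \oo] --> qd}.

Definition is_mean_delay (D : \bar R) : Prop :=
  {ae P, forall w, mean_sojourn K N R s0 (sample_path w) t @[t --> \oo] --> D}.

End LongRun.

Section Delay.
Context (R : realType).

Definition throughput (pS pR pa : R) : R := pS + pa * pR.

(* Average transmission delay; it is +oo when the mean queue length is. *)
Definition tau (pS pR pa : R) (qd : \bar R) : \bar R :=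
  ((qd + 1%:E) * ((throughput pS pR pa)^-1)%:E)%E.

(* The mean delay at R is not defined at alpha = 0 (no packet arrives there), and
   it is +oo when Q_d is unstable; monotonicity and convexity are those of a
   function from ]0, 1] to [0, +oo], and monotonicity is not required to be
   strict. *)
Definition increasing01 (f : R -> \bar R) : Prop :=
  forall a b : R, 0 < a -> a <= b -> b <= 1 -> (f a <= f b)%E.

Definition convex01 (f : R -> \bar R) : Prop :=
  forall a b t : R, 0 < a <= 1 -> 0 < b <= 1 -> 0 < t < 1 ->
    (f (t * a + (1 - t) * b)%R <= t%:E * f a + (1 - t)%:E * f b)%E.

Definition minimizes01 (f : R -> \bar R) (a : R) : Prop :=
  0 <= a <= 1 /\ forall b : R, 0 <= b <= 1 -> (f a <= f b)%E.

End Delay.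

(* Main.v *)
(* Idea.  Along almost every path Little's law holds: counting each packet
   present in Q_d once per slot shows that the integral of the queue up to t is,
   up to the initial packets, the sum of the sojourn times truncated at t.  Hence
   qd = lambda DR as soon as one side is finite, with lambda = alpha (1 - pS), and
   a finite qd forces pa pR = lambda.  The laws of large numbers needed for
   arrivals and for departures (compensated by pR times the activity) come from
   second moments of martingales, Chebyshev and Borel-Cantelli along t = k^4.
   At alpha = 0 a cylinder of positive probability empties Q_d, so pa = qd = 0
   and tau = 1 / pS.  For alpha > 0, with qd finite,
   tau = (lambda DR + 1) / (pS + lambda), which compares with 1 / pS as DR does,
   and by monotonicity the limit of DR at 0+ is its infimum. *)
Require Import Defs.
From HB Require Import structures.
From mathcomp Require Import all_boot all_order all_algebra.
From mathcomp Require Import all_classical all_reals all_analysis.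
From mathcomp Require Import zify ring lra.
Import Order.TTheory GRing.Theory Num.Theory.
Import numFieldNormedType.Exports.
Local Open Scope classical_set_scope.
Local Open Scope ring_scope.

(** * Little's law on a path *)

Section PathLittle.
Variables (R : realType) (bmax K N : nat) (s0 : qstate) (xs : nat -> draw bmax).

Definition arrivals (t : nat) : nat := (\sum_(0 <= n < t) arrives (xs n))%N.

Definition departures (t : nat) : nat :=
  (\sum_(0 <= n < t) departs_at K N s0 xs n)%N.

Lemma midslot_queue (s : qstate) (x : draw bmax) :
  (midslot N s x).1 = (s.1 + arrives x)%N.
Proof. by rewrite /midslot /arrives; case: dd_mode => //=; rewrite addn0. Qed.

(** Conservation of packets; the subtraction in [next_state] does not truncate, since an active slot
    has a nonempty queue after its first subslot. *)
Lemma next_state_queue (s : qstate) (x : draw bmax) :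
  ((next_state K N s x).1 + departs K N s x = s.1 + arrives x)%N.
Proof.
rewrite -(midslot_queue s) /next_state /departs.
case: (boolP (active K N s x)) => [/andP[m_gt0 _] /=|_]; last by rewrite addn0.
by rewrite subnK//; case: detR.
Qed.

Lemma queue_balance (t : nat) :
  ((state K N s0 xs t).1 + departures t = s0.1 + arrivals t)%N.
Proof.
rewrite /departures /arrivals; elim: t => [|t IH]; first by rewrite !big_nil.
rewrite !big_nat_recr//= addnCA [RHS]addnA -IH.
have := next_state_queue (state K N s0 xs t) (xs t).
by rewrite /departs_at /=; lia.
Qed.

Lemma qd_mid_balance (t : nat) :
  (qd_mid K N s0 xs t + departures t = s0.1 + arrivals t.+1)%N.
Proof.
rewrite /qd_mid midslot_queue /arrivals big_nat_recr//=.
by have := queue_balance t; rewrite /arrivals; lia.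
Qed.

Lemma qd_slotE (t : nat) :
  qd_slot K N R s0 xs t = (state K N s0 xs t).1%:R + (arrives (xs t))%:R / 2.
Proof. by rewrite /qd_slot /qd_mid midslot_queue natrD; lra. Qed.

Lemma leq_departures (m n : nat) :
  (m <= n)%N -> (departures m <= departures n)%N.
Proof. by move=> mn; rewrite /departures (big_cat_nat (leq0n _) mn)//= leq_addr. Qed.

Lemma leq_arrivals (m n : nat) : (m <= n)%N -> (arrivals m <= arrivals n)%N.
Proof. by move=> mn; rewrite /arrivals (big_cat_nat (leq0n _) mn)//= leq_addr. Qed.

(* By FCFS, the packet arriving in slot n is the (s0.1 + arrivals n.+1)-th to
   leave; it is present at the beginning of slot j > n iff it has not left. *)
Definition waiting (n j : nat) : bool :=
  (departures j < s0.1 + arrivals n.+1)%N.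

(** Time at R truncated at [t], without the half slot spent in slot [n] itself, which is added in
    [sum_qd_slot]. *)
Definition age (t n : nat) : nat := (\sum_(n.+1 <= j < t) waiting n j)%N.

(** The number [v] of departures is kept apart from [j], so that the induction over arrivals leaves
    it fixed. The truncated [s0.1 - v] discounts initial packets still present. *)
Lemma count_waiting (j v : nat) :
  (\sum_(0 <= n < j | arrives (xs n)) (v < s0.1 + arrivals n.+1) =
   (s0.1 + arrivals j - v) - (s0.1 - v))%N.
Proof.
elim: j => [|j IH].
  by rewrite big_nil /arrivals big_nil addn0 subnn.
rewrite big_mkcond big_nat_recr//= -big_mkcond IH.
rewrite /arrivals big_nat_recr//=; case: (arrives (xs j)) => /=.
  by rewrite -/(arrivals j); lia.
by rewrite !addn0.
Qed.

Lemma queue_waiting (j : nat) :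
  (state K N s0 xs j).1 = ((s0.1 - departures j) +
    \sum_(0 <= n < j | arrives (xs n)) waiting n j)%N.
Proof. by rewrite count_waiting; have := queue_balance j; lia. Qed.

Lemma sum_waiting (t : nat) :
  (\sum_(0 <= j < t) \sum_(0 <= n < j | arrives (xs n)) waiting n j =
   \sum_(0 <= n < t | arrives (xs n)) age t n)%N.
Proof.
elim: t => [|t IH]; first by rewrite !big_nil.
rewrite big_nat_recr//= IH [RHS]big_mkcond [RHS]big_nat_recr//=.
rewrite [age t.+1 t]big_geq// if_same addn0 -big_mkcond/= -big_split/=.
rewrite [LHS]big_nat_cond [RHS]big_nat_cond; apply: eq_bigr => n /andP[/andP[_ nt] _].
by rewrite /age big_nat_recr.
Qed.

Lemma sum_qd_slot (t : nat) :
  \sum_(0 <= j < t) qd_slot K N R s0 xs j =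
  \sum_(0 <= j < t) (s0.1 - departures j)%:R +
  \sum_(0 <= n < t | arrives (xs n)) ((age t n)%:R + 1 / 2) :> R.
Proof.
under eq_bigr do rewrite qd_slotE queue_waiting natrD -addrA.
rewrite 2!big_split/=; congr (_ + _).
rewrite big_split/= -[in RHS]natr_sum -sum_waiting natr_sum; congr (_ + _).
rewrite [RHS]big_mkcond; apply: eq_bigr => n _.
by case: arrives; rewrite ?mul0r.
Qed.

(** Adding the departures before slot [n] to both sides turns the FCFS criterion of [sojourn] into
    one on the rank of the packet among all packets. *)
Lemma sojourn_setE (n m : nat) : (n <= m)%N ->
  (qd_mid K N s0 xs n <= \sum_(n <= i < m.+1) departs_at K N s0 xs i)%N =
  (s0.1 + arrivals n.+1 <= departures m.+1)%N.
Proof.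
move=> nm; rewrite -qd_mid_balance addnC /departures.
by rewrite (big_cat_nat (leq0n _) (leqW nm))//= leq_add2l.
Qed.

(** A packet leaving in slot [m] is absent from slot [m.+1] on, so at most [m - n] slot beginnings
    count; if it never leaves, the infimum of the empty set is [+oo]. *)
Lemma age_le_sojourn (t n : nat) :
  (((age t n)%:R + 1 / 2)%:E <= sojourn K N R s0 xs n)%E.
Proof.
apply/ereal_infP => _ [m [nm]] /[!sojourn_setE]// mP <-.
rewrite lee_fin lerD2r ler_nat /age.
have w0 j : (m < j)%N -> waiting n j = false.
  by move=> mj; rewrite /waiting; have := leq_departures _ _ mj; lia.
have [tm|mt] := leqP t m.+1.
  apply: leq_trans (_ : \sum_(n.+1 <= j < t) 1 <= _)%N.
    by apply: leq_sum => j _; case: waiting.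
  by rewrite sum_nat_const_nat; lia.
rewrite (@big_cat_nat _ _ _ m.+1)//=; last exact: ltnW.
rewrite [X in (_ + X)%N]big_nat_cond [X in (_ + X)%N]big1 ?addn0; last first.
  by move=> j /andP[/andP[mj _] _]; rewrite w0.
apply: leq_trans (_ : \sum_(n.+1 <= j < m.+1) 1 <= _)%N.
  by apply: leq_sum => j _; case: waiting.
by rewrite sum_nat_const_nat; lia.
Qed.

(** Once the packet is gone its whole stay is counted: it waits at the start of every slot after [n]
    up to its departure slot. *)
Lemma sojourn_le_age (t n : nat) : (n < t)%N ->
  (s0.1 + arrivals n.+1 <= departures t)%N ->
  (sojourn K N R s0 xs n <= ((age t n)%:R + 1 / 2)%:E)%E.
Proof.
move=> nt Ht.
have [|m /andP[nm mP] m_min] := @ex_minnP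
    (fun k => (n <= k)%N && (s0.1 + arrivals n.+1 <= departures k.+1)%N).
  by exists t.-1; rewrite prednK ?Ht ?andbT; lia.
have mt : (m <= t.-1)%N.
  by apply: m_min; rewrite prednK ?Ht ?andbT; lia.
apply: (@le_trans _ _ ((m - n)%:R + 1 / 2)%:E).
  by apply: ereal_inf_lbound; exists m => //; split => //=; rewrite sojourn_setE.
rewrite lee_fin lerD2r ler_nat /age (@big_cat_nat _ _ _ m.+1)//=; last by lia.
apply: leq_trans (leq_addr _ _).
rewrite -subSS -[X in (X <= _)%N]muln1 -sum_nat_const_nat.
rewrite big_nat_cond [leqRHS]big_nat_cond; apply: leq_sum => j.
rewrite andbT => /andP[nj jm]; rewrite /waiting ltnNge.
(* Had the packet left before slot [j], slot [j.-1] would contradict the minimality of [m]. *)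
case: leqP => // jP; have := m_min j.-1.
by rewrite prednK ?jP; lia.
Qed.

Lemma sojourn_ge0 (n : nat) : (0 <= sojourn K N R s0 xs n)%E.
Proof. by apply: le_trans (age_le_sojourn 0 n); rewrite lee_fin addr_ge0. Qed.

(** All packets arrived before [t] have left by [t'], so their full stays are part of the queue
    integral up to [t']. *)
Lemma sum_sojourn_le (t t' : nat) : (t <= t')%N ->
  (s0.1 + arrivals t <= departures t')%N ->
  (\sum_(0 <= n < t | arrives (xs n)) sojourn K N R s0 xs n <=
   (\sum_(0 <= j < t') qd_slot K N R s0 xs j)%:E)%E.
Proof.
move=> tt' Ht; rewrite sum_qd_slot.
apply: (@le_trans _ _ (\sum_(0 <= n < t | arrives (xs n))
  ((age t' n)%:R + 1 / 2)%:E)%E).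
  rewrite big_nat_cond [leRHS]big_nat_cond.
  apply: lee_sum => n /andP[/andP[_ nt] _].
  apply: sojourn_le_age; first exact: leq_trans tt'.
  by apply: leq_trans Ht; rewrite leq_add2l leq_arrivals.
rewrite sumEFin lee_fin [X in _ <= _ + X](big_cat_nat (leq0n _) tt')//=.
rewrite addrCA.
by rewrite lerDl addr_ge0// sumr_ge0// => i _; rewrite addr_ge0.
Qed.

(** The initial packets are gone from slot [j0] on and contribute at most [s0.1] per slot before it;
    later ones contribute at most their full stays. *)
Lemma sum_qd_slot_le (t j0 : nat) : (s0.1 <= departures j0)%N ->
  ((\sum_(0 <= j < t) qd_slot K N R s0 xs j)%:E <=
   (s0.1 * j0)%:R%:E +
   \sum_(0 <= n < t | arrives (xs n)) sojourn K N R s0 xs n)%E.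
Proof.
move=> Hj0; rewrite sum_qd_slot EFinD leeD//; last first.
  by rewrite -sumEFin; apply: lee_sum => n _; exact: age_le_sojourn.
rewrite lee_fin -natr_sum ler_nat.
apply: (@leq_trans (\sum_(0 <= j < t) (if (j < j0)%N then s0.1 else 0))%N).
  apply: leq_sum => j _; case: ltnP => [_|j0j]; first exact: leq_subr.
  by rewrite leqn0 subn_eq0 (leq_trans Hj0)// leq_departures.
have [tj|jt] := leqP t j0.
  apply: leq_trans (_ : \sum_(0 <= j < t) s0.1 <= _)%N.
    by apply: leq_sum => j _; case: ifP.
  by rewrite sum_nat_const_nat subn0 mulnC leq_mul.
rewrite (@big_cat_nat _ _ _ j0)//=; last exact: ltnW.
rewrite [X in (_ + X)%N]big_nat_cond [X in (_ + X)%N]big1 ?addn0; last first.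
  by move=> j /andP[/andP[mj _] _]; rewrite ltnNge mj.
apply: leq_trans (_ : \sum_(0 <= j < j0) s0.1 <= _)%N.
  by apply: leq_sum => j _; case: ifP.
by rewrite sum_nat_const_nat subn0 mulnC.
Qed.

End PathLittle.

(** * Long-run averages on a path and the two halves of Little's law *)

Lemma cvgn_ge_id (h : nat -> nat) : (forall k, (k <= h k)%N) ->
  h k @[k --> \oo] --> \oo.
Proof.
move=> hge; apply/cvgnyPge => A; exists A => // k /= Ak.
exact: leq_trans (hge k).
Qed.

Lemma cvg_inv_nat (R : realType) (c : R) : c / k%:R @[k --> \oo] --> 0.
Proof.
rewrite -(mulr0 c); apply: cvgM; first exact: cvg_cst.
by apply/gtr0_cvgV0; [near=> k; rewrite ltr0n; near: k; exact: nbhs_infty_gt|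
  apply/cvgrnyP].
Unshelve. all: by end_near. Qed.

(* Along t = k^4 Chebyshev's bounds are summable, while the ratio of t = (m j)^4
   and t' = ((m+1) j)^4 can still be made arbitrarily close to 1. *)
Definition mean_null4 (R : realType) (f : nat -> R) : Prop :=
  (\sum_(0 <= n < k ^ 4) f n) / (k ^ 4)%:R @[k --> \oo] --> (0 : R).

Section PathLimits.
Variables (R : realType) (bmax K N : nat) (s0 : qstate) (xs : nat -> draw bmax).
Variables (lam pR pa : R) (qd D : \bar R).
Hypothesis lam_gt0 : 0 < lam.
Hypothesis arrivals_lln : mean_null4 R (fun n => (arrives (xs n))%:R - lam).
Hypothesis departures_lln : mean_null4 R (fun n =>
  (departs_at K N s0 xs n)%:R - pR * (active_at K N s0 xs n)%:R).
Hypothesis active_cvg :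
  time_avg (fun n => (active_at K N s0 xs n)%:R) t @[t --> \oo] --> pa%:E.
Hypothesis queue_cvg : time_avg (qd_slot K N R s0 xs) t @[t --> \oo] --> qd.
Hypothesis sojourn_cvg : mean_sojourn K N R s0 xs t @[t --> \oo] --> D.

Let arr := arrivals bmax xs.
Let dep := departures bmax K N s0 xs.
Let q t := (state K N s0 xs t).1.
Let S t := \sum_(0 <= j < t) qd_slot K N R s0 xs j.

Let ge_id4 k : (k <= k ^ 4)%N.
Proof. by case: k => // k; rewrite -{1}(expn1 k.+1) leq_pexp2l. Qed.

Let cvg4 : (k ^ 4)%N @[k --> \oo] --> \oo.
Proof. by apply: cvgn_ge_id; exact: ge_id4. Qed.

Lemma cvg_arrivals4 : (arr (k ^ 4))%:R / (k ^ 4)%:R @[k --> \oo] --> lam.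
Proof.
rewrite -[lam in _ --> lam]add0r.
apply: cvg_trans (cvgD arrivals_lln (@cvg_cst _ lam _ _ _)).
apply: near_eq_cvg; near=> k.
have k_gt0 : (0 < k)%N by near: k; exact: nbhs_infty_gt.
have k4 : (k ^ 4)%:R != 0 :> R by rewrite pnatr_eq0 -lt0n expn_gt0 k_gt0.
rewrite fctE big_split/= sumrN sumr_const_nat subn0 -natr_sum -/(arr _).
by rewrite mulrBl -[lam *+ _]mulr_natr mulfK// subrK.
Unshelve. all: by end_near. Qed.

(** An empty average has value 0 by convention, so lower bounds on [mean_sojourn] need at least one
    arrival. *)
Lemma arrivals4_gt0 : \forall k \near \oo, (0 < arr (k ^ 4))%N.
Proof.
near=> k.
have : 0 < (arr (k ^ 4))%:R / (k ^ 4)%:R :> R.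
  by near: k; exact: (cvgr_gt _ cvg_arrivals4).
by rewrite lt0n; apply: contraTneq => ->; rewrite mul0r ltxx.
Unshelve. all: by end_near. Qed.

Lemma sum_sojournE (t : nat) : (0 < arr t)%N ->
  (\sum_(0 <= n < t | arrives (xs n)) sojourn K N R s0 xs n =
   (arr t)%:R%:E * mean_sojourn K N R s0 xs t)%E.
Proof.
move=> A_gt0; rewrite /mean_sojourn muleC -muleA -EFinM mulVf ?mule1//.
by rewrite pnatr_eq0 -lt0n.
Qed.

Lemma mean_sojourn_ge (M : R) (t : nat) :
  (forall n, M%:E <= sojourn K N R s0 xs n)%E -> (0 < arr t)%N ->
  (M%:E <= mean_sojourn K N R s0 xs t)%E.
Proof.
move=> HM A_gt0; rewrite /mean_sojourn lee_pdivlMr ?ltr0n//.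
rewrite -EFinM.
apply: (@le_trans _ _ (\sum_(0 <= n < t | arrives (xs n)) M%:E)%E); last first.
  exact: lee_sum.
rewrite sumEFin lee_fin natr_sum mulr_sumr [leRHS]big_mkcond/=.
by apply: ler_sum => n _; case: arrives; rewrite ?mulr1 ?mulr0.
Qed.

Lemma mean_delay_ge0 : (0 <= D)%E.
Proof.
have := cvg_comp _ _ cvg4 sojourn_cvg; apply: cvge_ge.
near=> k; apply: mean_sojourn_ge => [n|]; first exact: sojourn_ge0.
by near: k; exact: arrivals4_gt0.
Unshelve. all: by end_near. Qed.

(** Otherwise FCFS keeps every later packet at R forever, all sojourn times are [+oo], and so is
    their mean. *)
Lemma initial_packets_leave : (D < +oo)%E -> exists j, (s0.1 <= dep j)%N.
Proof.
move=> Doo; apply: contrapT => Hn.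
have never j : (dep j < s0.1)%N by rewrite ltnNge; apply/negP => H; apply: Hn; exists j.
have soo n : sojourn K N R s0 xs n = +oo%E.
  rewrite /sojourn; set B := (X in [set _ | _ in X]).
  suff -> : B = set0 by rewrite image_set0 ereal_inf0.
  apply/seteqP; split => // m [nm]; rewrite sojourn_setE//.
  by have := never m.+1; rewrite /dep; lia.
have Dge (M : R) : (M%:E <= D)%E.
  have := cvg_comp _ _ cvg4 sojourn_cvg; apply: cvge_ge.
  near=> k; apply: mean_sojourn_ge => [n|]; first by rewrite soo leey.
  by near: k; exact: arrivals4_gt0.
have Dfin : D \is a fin_num by rewrite ge0_fin_numE ?mean_delay_ge0.
by have := Dge (fine D + 1); rewrite -[leRHS]fineK// lee_fin; lra.
Unshelve. all: by end_near. Qed.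

(** Divide [sum_qd_slot_le] by [t = k ^ 4]: the initial packets vanish in the limit and the arrivals
    per slot tend to [lam]. *)
Lemma queue_le_little : (D < +oo)%E -> (qd <= lam%:E * D)%E.
Proof.
move=> Doo; have [j0 Hj0] := initial_packets_leave Doo.
have Dfin : D \is a fin_num by rewrite ge0_fin_numE ?mean_delay_ge0.
pose C : R := (s0.1 * j0)%:R.
have inv0 := cvg_comp _ _ cvg4 (cvg_inv_nat R C).
have lim1 : (C / (k ^ 4)%:R)%:E @[k --> \oo] --> 0%:E.
  by apply: cvg_EFin => //; exact: nearW.
have lim2 : ((arr (k ^ 4))%:R / (k ^ 4)%:R)%:E @[k --> \oo] --> lam%:E.
  by apply: cvg_EFin; [exact: nearW|exact: cvg_arrivals4].
have lim3 : ((C / (k ^ 4)%:R)%:E + ((arr (k ^ 4))%:R / (k ^ 4)%:R)%:E *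
    mean_sojourn K N R s0 xs (k ^ 4))%E @[k --> \oo] --> (0 + lam%:E * D)%E.
  apply: cvgeD lim1 _; first by rewrite fin_num_adde_defr.
  apply: cvgeM lim2 _; first by exact: mule_def_fin.
  exact: (cvg_comp _ _ cvg4 sojourn_cvg).
rewrite -[leRHS]add0e.
apply: (lee_cvg_to (cvg_comp _ _ cvg4 queue_cvg) lim3).
near=> k.
have A_gt0 : (0 < arr (k ^ 4))%N by near: k; exact: arrivals4_gt0.
have k4 : 0 < (k ^ 4)%:R :> R by rewrite ltr0n expn_gt0 orbF; near: k; exact: nbhs_infty_gt.
have := sum_qd_slot_le R bmax K N s0 xs (k ^ 4) j0 Hj0.
rewrite (sum_sojournE _ A_gt0) -/C => /(lee_wpmul2r _).
move=> /(_ ((k ^ 4)%:R^-1)%:E); rewrite lee_fin invr_ge0 ltW// => /(_ isT).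
rewrite -EFinM /time_avg /=; move/le_trans; apply.
rewrite muleDl//.
by rewrite -EFinM muleAC -EFinM.
Unshelve. all: by end_near. Qed.

(** The queue after slot [t] is at most twice the increment of [S] in that slot, and the increments
    of a sequence with [S t / t] convergent are [o(t)]. *)
Lemma cvg_queue_null (r : R) : qd = r%:E -> (q t)%:R / t%:R @[t --> \oo] --> (0 : R).
Proof.
move=> qdr; have S_cvg : S t / t%:R @[t --> \oo] --> r.
  by move: queue_cvg; rewrite qdr => /fine_cvg.
rewrite -cvg_shiftS /=.
have lim : 2 * (S t.+1 / t.+1%:R - S t / t%:R * (1 - t.+1%:R^-1)) @[t --> \oo]
    --> 2 * (r - r * (1 - 0)).
  apply: cvgM; first exact: cvg_cst.
  apply: cvgB; first by rewrite (cvg_shiftS (fun t => S t / t%:R)).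
  apply: cvgM => //; apply: cvgB; first exact: cvg_cst.
  exact: cvg_harmonic.
move: lim; rewrite subr0 mulr1 subrr mulr0 => lim.
apply: (squeeze_cvgr _ (@cvg_cst _ 0 _ _ _) lim).
near=> t; rewrite divr_ge0//=.
have t_gt0 : (0 < t)%N by near: t; exact: nbhs_infty_gt.
have tn0 : t%:R != 0 :> R by rewrite pnatr_eq0 -lt0n.
have -> : S t / t%:R * (1 - t.+1%:R^-1) = S t / t.+1%:R.
  by rewrite -natr1; field; rewrite tn0 natr1 pnatr_eq0.
rewrite -mulrBl mulrA ler_wpM2r ?invr_ge0//.
rewrite /S big_nat_recr//= [_ + qd_slot _ _ _ _ _ _]addrC addrK.
rewrite /qd_slot mulrC divfK ?pnatr_eq0// -natrD ler_nat.
have := next_state_queue bmax K N (state K N s0 xs t) (xs t).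
by rewrite /qd_mid midslot_queue /q /=; lia.
Unshelve. all: by end_near. Qed.

Lemma little_le_queue : (lam%:E * D <= qd)%E.
Proof.
have qd_ge0 : (0 <= qd)%E.
  apply: cvge_ge queue_cvg; apply: nearW => t; rewrite lee_fin.
  by rewrite divr_ge0// sumr_ge0// => j _; rewrite divr_ge0// addr_ge0.
have [qdoo|qdoo] := ltP qd +oo%E; last first.
  by move: qdoo; rewrite leye_eq => /eqP ->; rewrite leey.
have qdfin : qd \is a fin_num by rewrite ge0_fin_numE.
pose r := fine qd; have qdr : qd = r%:E by rewrite fineK.
have S_cvg : S t / t%:R @[t --> \oo] --> r.
  by move: queue_cvg; rewrite qdr => /fine_cvg.
(* Compare slots (m.+1 j)^4 and (m.+2 j)^4: as the queue is o(t), all packets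
   that arrived before the former have left by the latter. *)
have bound (m : nat) : (lam%:E * D <= (r * (1 + m.+1%:R^-1) ^+ 4)%:E)%E.
  have cvgm : (m.+1 * j)%N @[j --> \oo] --> \oo.
    by apply: cvgn_ge_id => j; rewrite leq_pmull.
  have cvgm' : (m.+2 * j)%N @[j --> \oo] --> \oo.
    by apply: cvgn_ge_id => j; rewrite leq_pmull.
  have A1 := cvg_comp _ _ cvgm cvg_arrivals4.
  have A2 := cvg_comp _ _ cvgm' cvg_arrivals4.
  have Q2 := cvg_comp _ _ cvgm' (cvg_comp _ _ cvg4 (cvg_queue_null _ qdr)).
  have S2 := cvg_comp _ _ cvgm' (cvg_comp _ _ cvg4 S_cvg).
  have M1 := cvg_comp _ _ cvgm (cvg_comp _ _ cvg4 sojourn_cvg).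
  have lhs : (((arr ((m.+1 * j) ^ 4))%:R / ((m.+1 * j) ^ 4)%:R)%:E *
      mean_sojourn K N R s0 xs ((m.+1 * j) ^ 4))%E @[j --> \oo] --> (lam%:E * D)%E.
    apply: cvgeM; [|by apply: cvg_EFin; [exact: nearW|exact: A1]|exact: M1].
    have [->|D0] := eqVneq D 0%E; first by rewrite mule_def_fin.
    by rewrite neq0_mule_def// mule_neq0// eqe gt_eqF.
  have rhs : (S ((m.+2 * j) ^ 4) / ((m.+2 * j) ^ 4)%:R *
      (1 + m.+1%:R^-1) ^+ 4)%:E @[j --> \oo] --> (r * (1 + m.+1%:R^-1) ^+ 4)%:E.
    apply: cvg_EFin; first exact: nearW.
    by apply: cvgM; [exact: S2|exact: cvg_cst].
  (* Later arrivals minus earlier arrivals minus the queue, divided by [j ^ 4]. The limit is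
     positive, so by [queue_balance] the departures eventually cover the initial packets and all
     earlier arrivals. *)
  pose g j : R :=
    (arr ((m.+2 * j) ^ 4))%:R / ((m.+2 * j) ^ 4)%:R * m.+2%:R ^+ 4
    - (arr ((m.+1 * j) ^ 4))%:R / ((m.+1 * j) ^ 4)%:R * m.+1%:R ^+ 4
    - (q ((m.+2 * j) ^ 4))%:R / ((m.+2 * j) ^ 4)%:R * m.+2%:R ^+ 4.
  have gap : g j @[j --> \oo] -->
      lam * m.+2%:R ^+ 4 - lam * m.+1%:R ^+ 4 - 0 * m.+2%:R ^+ 4.
    apply: cvgB; [apply: cvgB|]; apply: cvgM; try exact: cvg_cst;
      [exact: A2|exact: A1|exact: Q2].
  have gap_gt0 : 0 < lam * m.+2%:R ^+ 4 - lam * m.+1%:R ^+ 4 - 0 * m.+2%:R ^+ 4.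
    by rewrite mul0r subr0 -mulrBr mulr_gt0// subr_gt0 ltrXn2r// ltr_nat.
  apply: (lee_cvg_to lhs rhs); near=> j.
  have j_gt0 : (0 < j)%N by near: j; exact: nbhs_infty_gt.
  have jn0 : j%:R != 0 :> R by rewrite pnatr_eq0 -lt0n.
  have A_gt0 : (0 < arr ((m.+1 * j) ^ 4))%N.
    by near: j; exact: (cvgm _ arrivals4_gt0).
  have tt' : ((m.+1 * j) ^ 4 <= (m.+2 * j) ^ 4)%N by rewrite leq_exp2r// leq_mul.
  have Ht : (s0.1 + arr ((m.+1 * j) ^ 4) <= dep ((m.+2 * j) ^ 4))%N.
    have : (q ((m.+2 * j) ^ 4) + arr ((m.+1 * j) ^ 4) <= arr ((m.+2 * j) ^ 4))%N.
      rewrite -(ler_nat R) natrD; apply: ltW.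
      rewrite -subr_gt0 -(pmulr_lgt0 _ (_ : 0 < (j%:R ^+ 4)^-1)); last first.
        by rewrite invr_gt0 exprn_gt0// ltr0n.
      have : 0 < g j by near: j; exact: (cvgr_gt _ gap).
      congr (_ < _); rewrite /g !natrX !natrM.
      by field; rewrite jn0 -?natrD ?nat1r !pnatr_eq0.
    by have := queue_balance bmax K N s0 xs ((m.+2 * j) ^ 4); rewrite /dep /arr /q; lia.
  have := sum_sojourn_le R bmax K N s0 xs _ _ tt' Ht.
  rewrite (sum_sojournE _ A_gt0) => /(lee_wpmul2r _).
  move=> /(_ (((m.+1 * j) ^ 4)%:R^-1)%:E); rewrite lee_fin invr_ge0 ler0n.
  move=> /(_ isT); rewrite muleAC -!EFinM => /le_trans; apply.
  rewrite lee_fin le_eqVlt; apply/orP; left; apply/eqP.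
  rewrite -/(S _) !natrX !natrM.
  by field; rewrite jn0 -?natrD ?nat1r !pnatr_eq0.
(* As [m] grows, the ratio of the two times tends to 1 and the bound to [qd]. *)
apply: (@cvge_ge _ \oo _ _ (fun m => (r * (1 + m.+1%:R^-1) ^+ 4)%:E)).
  exact: nearW.
have -> : qd = (r * (1 + 0) ^+ 4)%:E by rewrite qdr addr0 expr1n mulr1.
apply: cvg_EFin; first exact: nearW.
apply: cvgM; first exact: cvg_cst.
apply: (cvg_comp (fun m => 1 + m.+1%:R^-1) (fun x : R => x ^+ 4));
  last exact: exprn_continuous.
apply: cvgD; first exact: cvg_cst.
exact: cvg_harmonic.
Unshelve. all: by end_near. Qed.

(** By [queue_balance], departures differ from arrivals by [o(t)], so their rate is [lam]; the
    compensated departures give the rate [pa * pR]. *)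
Lemma departure_rate (r : R) : qd = r%:E -> pa * pR = lam.
Proof.
move=> qdr.
have qlim := cvg_comp _ _ cvg4 (cvg_queue_null _ qdr).
have inv := cvg_comp _ _ cvg4 (cvg_inv_nat R s0.1%:R).
have act : (\sum_(0 <= n < t) (active_at K N s0 xs n)%:R) / t%:R @[t --> \oo] --> pa.
  by move: active_cvg => /fine_cvg.
have act4 := cvg_comp _ _ cvg4 act.
have dlim : (dep (k ^ 4))%:R / (k ^ 4)%:R @[k --> \oo] --> 0 + lam - 0.
  apply: cvg_trans (cvgB (cvgD inv cvg_arrivals4) qlim).
  apply: near_eq_cvg; near=> k; rewrite !fctE/=.
  rewrite -mulrDl -mulrBl -natrD /arr -(queue_balance bmax K N s0 xs).
  by rewrite natrD addrAC subrr add0r.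
have dlim' : (dep (k ^ 4))%:R / (k ^ 4)%:R @[k --> \oo] --> 0 + pR * pa.
  apply: cvg_trans (cvgD departures_lln (cvgM (@cvg_cst _ pR _ _ _) act4)).
  apply: near_eq_cvg; near=> k; rewrite !fctE/=.
  rewrite big_split/= sumrN -mulr_sumr mulrA -mulrDl subrK.
  by rewrite -natr_sum.
have := cvg_unique _ dlim dlim'.
by rewrite add0r subr0 add0r mulrC => ->.
Unshelve. all: by end_near. Qed.

End PathLimits.

(** * Law of large numbers for martingales on finite words *)

Section WordMartingale.
Variables (R : realType) (d : measure_display) (T : measurableType d).
Variables (P : probability T R) (A : finType) (w : A -> R).
Variable X : nat -> T -> A.
Hypothesis w_ge0 : forall x, 0 <= w x.
Hypothesis w_sum : \sum_x w x = 1.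
Hypothesis X_meas : forall n x, measurable [set v | X n v = x].
Hypothesis X_law : forall (n : nat) (x : 'I_n -> A),
  P [set v | forall i : 'I_n, X i v = x i] = (\prod_(i < n) w (x i))%:E.

Definition prefix_at (v : T) (n : nat) : seq A := mkseq (X^~ v) n.

Lemma prefix_at_law (h : seq A) :
  P [set v | prefix_at v (size h) = h] = (\prod_(x <- h) w x)%:E.
Proof.
rewrite big_tnth -X_law; congr (P _); apply/seteqP; split => v /=.
  move=> vh i; rewrite (tnth_nth (X i v)) /=.
  have := nth_mkseq (X i v) (X^~ v) (ltn_ord i).
  by rewrite -/(prefix_at v _) vh.
move=> vh; apply: (@eq_from_nth _ (X 0%N v)); rewrite size_mkseq// => i ih.
by rewrite nth_mkseq// (vh (Ordinal ih)) (tnth_nth (X 0%N v)).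
Qed.

Lemma measurable_prefix_at (h : seq A) :
  measurable [set v | prefix_at v (size h) = h].
Proof.
elim/last_ind: h => [|h x IH]; first by rewrite (_ : mkset _ = setT)//; exact/seteqP.
rewrite (_ : mkset _ = [set v | prefix_at v (size h) = h] `&`
                       [set v | X (size h) v = x]); first exact: measurableI.
apply/seteqP; split => v /=; rewrite size_rcons /prefix_at mkseqS.
  by move=> /rcons_inj[].
by move=> [-> ->].
Qed.

(** For each [n], finitely many words of length [n.+1] have weight zero; their cylinders are null
    and cover the paths whose draw [n] has weight zero. *)
Lemma ae_law_neq0 : {ae P, forall v, forall n, w (X n v) != 0}.
Proof.
apply/ae_foralln => n.
pose D := [set h : n.+1.-tuple A | \prod_(x <- h) w x = 0].
pose B := \bigcup_(h in D) [set v | prefix_at v (size h) = h].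
have finD : finite_set D by exact: finite_finset.
have mB : measurable B.
  by apply: fin_bigcup_measurable => // h _; exact: measurable_prefix_at.
exists B; split => //.
  apply/eqP; rewrite eq_le measure_ge0 andbT.
  apply: (@le_trans _ _ (\sum_(h \in D) P [set v | prefix_at v (size h) = h])%E).
    by apply: content_sub_fsum => // h _; exact: measurable_prefix_at.
  by rewrite fsbig1// => h Dh; rewrite prefix_at_law Dh.
move=> v /= /negP; rewrite negbK => /eqP wv0.
have sz : size (prefix_at v n.+1) == n.+1 by rewrite /prefix_at size_mkseq.
exists (Tuple sz); last exact: (congr1 (prefix_at v) (eqP sz)).
by rewrite /D /= /prefix_at mkseqS -cats1 big_cat big_seq1 /= wv0 mulr0.
Qed.

Lemma ae_meets_prefix (h : seq A) (Q : T -> Prop) :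
  0 < \prod_(x <- h) w x -> {ae P, forall v, Q v} ->
  exists2 v, prefix_at v (size h) = h & Q v.
Proof.
move=> w_gt0 [B [mB B0 QB]]; apply: contrapT => noQ.
have : (P [set v | prefix_at v (size h) = h] <= P B)%E.
  apply: le_measure; rewrite ?inE//; first exact: measurable_prefix_at.
  by move=> v /= vh; apply: QB => /= Qv; apply: noQ; exists v.
by rewrite prefix_at_law B0 lee_fin leNgt w_gt0.
Qed.

Variable M : seq A -> R.
Hypothesis M_step : forall h x, `|M (rcons h x) - M h| <= 1.
Hypothesis M_martingale : forall h, \sum_x w x * (M (rcons h x) - M h) = 0.
Hypothesis M0 : M [::] = 0.

(** The cross term averages to zero by the martingale property, and the squared increment is at most
    1. The constant [c] stands for the steps still to come. *)
Lemma second_moment_step (h : seq A) (c : R) :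
  \sum_x w x * (M (rcons h x) ^+ 2 + c) <= M h ^+ 2 + 1 + c.
Proof.
have -> : M h ^+ 2 + 1 + c =
    \sum_x w x * (M h ^+ 2 + 1 + c + 2 * M h * (M (rcons h x) - M h)).
  under eq_bigr do rewrite mulrDr (mulrCA _ (2 * M h)).
  by rewrite big_split/= -mulr_suml w_sum mul1r -mulr_sumr M_martingale mulr0 addr0.
apply: ler_sum => x _; apply: ler_wpM2l => //.
have : (M (rcons h x) - M h) ^+ 2 <= 1.
  by rewrite -[leRHS](expr1n _ 2) -real_normK ?num_real// lerXn2r ?nnegrE.
by nra.
Qed.

(** Fixing a prefix [h] allows a recursion on the remaining steps [n], with finite sums in place of
    conditional expectations. *)
Definition deviation (c : R) (n : nat) (h : seq A) : set T :=
  [set v | prefix_at v (size h) = h /\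
           c <= `|M (prefix_at v (size h + n))|].

Lemma deviation_split (c : R) (n : nat) (h : seq A) :
  deviation c n.+1 h = \bigcup_(x in [set: A]) deviation c n (rcons h x).
Proof.
apply/seteqP; split => v /=.
  move=> [vh vM]; exists (X (size h) v) => //; split.
    by rewrite size_rcons /prefix_at mkseqS -/(prefix_at _ _) vh.
  by rewrite size_rcons addSnnS.
move=> [x _ [+ +]]; rewrite size_rcons /prefix_at mkseqS addSnnS.
by move=> /rcons_inj[vh _].
Qed.

Lemma measurable_deviation (c : R) (n : nat) (h : seq A) :
  measurable (deviation c n h).
Proof.
elim: n h => [|n IH] h; last first.
  by rewrite deviation_split; apply: fin_bigcup_measurable.
have [cM|cM] := leP c `|M h|.
  rewrite (_ : deviation _ _ _ = [set v | prefix_at v (size h) = h]).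
    exact: measurable_prefix_at.
  by apply/seteqP; split => v; [case|move=> /= vh; split => //; rewrite addn0 vh].
rewrite (_ : deviation _ _ _ = set0)//; apply/seteqP; split => // v [].
by rewrite addn0 => ->; rewrite leNgt cM.
Qed.

(** Chebyshev's bound on the cylinder of [h]. Splitting on the next letter and averaging with
    [second_moment_step] uses up one unit of [n]. *)
Lemma deviation_le (c : R) (n : nat) (h : seq A) : 0 < c ->
  (P (deviation c n h) <=
   ((\prod_(x <- h) w x) * (M h ^+ 2 + n%:R) / c ^+ 2)%:E)%E.
Proof.
move=> c_gt0; elim: n h => [|n IH] h.
  have [cM|cM] := leP c `|M h|.
    apply: (@le_trans _ _ (P [set v | prefix_at v (size h) = h])).
      apply: le_measure; rewrite ?inE; [exact: measurable_deviation|
        exact: measurable_prefix_at|by move=> v []].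
    rewrite prefix_at_law lee_fin -mulrA ler_peMr ?prodr_ge0//.
    rewrite addr0 ler_pdivlMr ?exprn_gt0// mul1r -[leRHS]real_normK ?num_real//.
    by rewrite lerXn2r// nnegrE ltW.
  rewrite (_ : deviation _ _ _ = set0) ?measure0 ?lee_fin.
    by rewrite divr_ge0 ?sqr_ge0// mulr_ge0 ?prodr_ge0// addr0 sqr_ge0.
  apply/seteqP; split => // v [].
  by rewrite addn0 => ->; rewrite leNgt cM.
apply: (@le_trans _ _ (\sum_(x : A) P (deviation c n (rcons h x)))%E).
  rewrite (@fsbig_seq _ _ _ _ (index_enum A)) ?index_enum_uniq//; apply: content_sub_fsum.
  - exact: finite_seq.
  - by move=> x _; exact: measurable_deviation.
  - exact: measurable_deviation.
  - rewrite deviation_split => v [x _ vx]; exists x => //=.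
    exact: mem_index_enum.
apply: (le_trans (lee_sum _ (fun x _ => IH (rcons h x)))).
rewrite sumEFin lee_fin -mulr_suml ler_wpM2r ?invr_ge0 ?sqr_ge0//.
have -> : \sum_x \prod_(y <- rcons h x) w y * (M (rcons h x) ^+ 2 + n%:R) =
    \sum_x (\prod_(y <- h) w y) * (w x * (M (rcons h x) ^+ 2 + n%:R)).
  by apply: eq_bigr => x _; rewrite -cats1 big_cat big_seq1 mulrA.
rewrite -mulr_sumr ler_wpM2l ?prodr_ge0//.
by rewrite -natr1 [n%:R + 1]addrC addrA second_moment_step.
Qed.

(** With time [n = k.+1 ^ 4] and threshold [c = k.+1 ^ 3], the bound [n / c ^ 2] is summable while
    [c / n] still tends to 0. *)
Let P_large (k : nat) :
  (P (deviation (k.+1%:R ^+ 3) (k.+1 ^ 4) [::]) <= (k.+1%:R ^- 2)%:E)%E.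
Proof.
have k0 : k.+1%:R != 0 :> R by rewrite pnatr_eq0.
apply: (le_trans (deviation_le _ _ _ _)); first by rewrite exprn_gt0.
rewrite big_nil M0 expr0n/= mul1r add0r lee_fin natrX.
by rewrite le_eqVlt; apply/orP; left; apply/eqP; field; rewrite nat1r.
Qed.

Let sum_inv_sqr (n : nat) :
  \sum_(0 <= k < n) k.+1%:R ^- 2 <= 2 - 2 / n.+1%:R :> R.
Proof.
elim: n => [|n IH]; first by rewrite big_nil; lra.
rewrite big_nat_recr//=; apply: (le_trans (lerD IH (lexx _))).
rewrite -subr_ge0.
have -> : 2 - 2 / n.+2%:R - (2 - 2 / n.+1%:R + n.+1%:R ^- 2) =
  n%:R / (n.+1%:R ^+ 2 * n.+2%:R) :> R.
  by field; rewrite -natrD nat1r !pnatr_eq0.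
by rewrite divr_ge0// mulr_ge0// exprn_ge0.
Qed.

Lemma martingale_lln : {ae P, forall v,
  M (prefix_at v (k ^ 4)) / (k ^ 4)%:R @[k --> \oo] --> (0 : R)}.
Proof.
pose F k := deviation (k.+1%:R ^+ 3) (k.+1 ^ 4) [::].
have mF k : measurable (F k) by exact: measurable_deviation.
have F0 : P (lim_sup_set F) = 0.
  apply: lim_sup_set_cvg0 => //; apply: (@le_lt_trans _ _ 2%:E); last exact: ltry.
  apply: lime_le; first exact: is_cvg_nneseries.
  apply: nearW => n; apply: (@le_trans _ _ (\sum_(0 <= k < n) (k.+1%:R ^- 2)%:E)%E).
    by apply: lee_sum => k _; exact: P_large.
  rewrite sumEFin lee_fin (le_trans (sum_inv_sqr n))//.
  by rewrite gerBl divr_ge0.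
exists (lim_sup_set F); split => //.
  by apply: bigcap_measurable => // k _; exact: bigcup_measurable.
(* Contrapositive: on a path avoiding every [F j] with [j >= k], the averages are at most [1 / j.+1]
   from there on, hence converge. *)
move=> v /= nv k _; apply: contrapT => Fn; apply: nv.
have small j : (k <= j)%N ->
    `|M (prefix_at v (j.+1 ^ 4)) / (j.+1 ^ 4)%:R| <= j.+1%:R^-1.
  move=> kj; have [//|cM] := leP (`|M (prefix_at v (j.+1 ^ 4))|) (j.+1%:R ^+ 3).
    rewrite normrM normfV [`|_%:R|]ger0_norm// ler_pdivrMr ?ltr0n ?expn_gt0//.
    by rewrite natrX exprS mulKf ?pnatr_eq0.
  by exfalso; apply: Fn; exists j => //; split => //; rewrite add0n ltW.
rewrite -cvg_shiftS /=.
apply/cvgr0Pnorm_le => e e_gt0.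
have := @cvg_harmonic R; move=> /cvgr0Pnorm_le/(_ _ e_gt0) He.
near=> j; apply: le_trans (small j _) _; first by near: j; exact: nbhs_infty_ge.
apply: le_trans (ler_norm _) _.
by near: j; exact: He.
Unshelve. all: by end_near. Qed.

End WordMartingale.
Arguments prefix_at {d T A} X v n.

(** * Static policies *)

Lemma sum_pair_mul (R : pzSemiRingType) (I J : finType) (F : I -> R) (G : J -> R) :
  \sum_(x : I * J) F x.1 * G x.2 = (\sum_i F i) * (\sum_j G j).
Proof.
by rewrite -(pair_bigA _ (fun i j => F i * G j))/= big_distrlr.
Qed.

Section StaticPolicy.
Variables (R : realType) (bmax K N : nat) (alpha pS pR : R).
Variable gamma : 'I_bmax.+1 -> R.
Hypothesis alpha01 : 0 <= alpha <= 1.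
Hypothesis pS01 : 0 < pS < 1.
Hypothesis pR01 : 0 < pR < 1.
Hypothesis gamma_ge0 : forall m, 0 <= gamma m.
Hypothesis gamma_sum : \sum_(m < bmax.+1) gamma m = 1.

Let A : finType := (bool * bool * 'I_bmax.+1 * bool)%type.
Let w : A -> R := draw_law alpha pS pR gamma.

Lemma bern_ge0 (p : R) (b : bool) : 0 <= p <= 1 -> 0 <= bern p b.
Proof. by move=> /andP[? ?]; rewrite /bern; case: b; rewrite ?subr_ge0. Qed.

Lemma draw_law_ge0 (x : A) : 0 <= w x.
Proof.
move: pS01 pR01 => /andP[pS0 pS1] /andP[pR0 pR1].
by rewrite /w /draw_law !mulr_ge0// bern_ge0// ?ltW.
Qed.

Lemma sum_draw (f g h : bool -> R) (e : 'I_bmax.+1 -> R) :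
  \sum_(x : A) f x.1.1.1 * g x.1.1.2 * e x.1.2 * h x.2 =
  (\sum_b f b) * (\sum_b g b) * (\sum_m e m) * (\sum_b h b).
Proof.
rewrite (sum_pair_mul _ _ _ (fun y => f y.1.1 * g y.1.2 * e y.2) h).
by rewrite (sum_pair_mul _ _ _ (fun y => f y.1 * g y.2) e) sum_pair_mul.
Qed.

Lemma draw_law_sum : \sum_x w x = 1.
Proof.
rewrite /w /draw_law (sum_draw (bern alpha) (bern pS) (bern pR) gamma).
by rewrite gamma_sum !big_bool /bern /=; ring.
Qed.

Lemma arrival_mean : \sum_x w x * (arrives x)%:R = alpha * (1 - pS).
Proof.
transitivity (\sum_(x : A) (bern alpha x.1.1.1 * (x.1.1.1)%:R) *
    (bern pS x.1.1.2 * (~~ x.1.1.2)%:R) * gamma x.1.2 * bern pR x.2).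
  apply: eq_bigr => x _; rewrite /w /draw_law /arrives /dd_mode /detS -mulnb natrM.
  by rewrite /harvest /detR; ring.
rewrite (sum_draw (fun b => bern alpha b * b%:R)
  (fun b => bern pS b * (~~ b)%:R) (bern pR) gamma).
by rewrite gamma_sum !big_bool /bern /=; ring.
Qed.

(** Activity does not depend on the component [detR] of the draw, so given the other components a
    departure has mean [pR] times the activity. *)
Lemma departure_compensated (s : qstate) :
  \sum_x w x * ((departs K N s x)%:R - pR * (active K N s x)%:R) = 0.
Proof.
rewrite -(pair_bigA _ (fun y b => w (y, b) *
  ((departs K N s (y, b))%:R - pR * (active K N s (y, b))%:R)))/=.
rewrite big1// => y _.
have act b : active K N s (y, b) = active K N s (y, true) by [].
rewrite big_bool /w /draw_law /departs /= !act.
by rewrite /bern /detR /dd_mode /detS /harvest/=; case: active => /=; ring.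
Qed.

Variables (d : measure_display) (T : measurableType d) (P : probability T R).
Variables (s0 : qstate) (X : nat -> T -> draw bmax).
Hypothesis X_iid : iid_draws P alpha pS pR gamma X.

Let X_meas (n : nat) (x : A) : measurable [set v | X n v = x].
Proof. by have [H _] := X_iid; exact: H. Qed.

Let X_law (n : nat) (x : 'I_n -> A) :
  P [set v | forall i : 'I_n, X i v = x i] = (\prod_(i < n) w (x i))%:E.
Proof. by have [_ H] := X_iid; exact: H. Qed.

Lemma arrivals_lln : {ae P, forall v,
  mean_null4 R (fun n => (arrives (sample_path X v n))%:R - alpha * (1 - pS))}.
Proof.
pose M (h : seq A) := \sum_(x <- h) ((arrives x)%:R - alpha * (1 - pS)).
have M_rcons h x : M (rcons h x) - M h = (arrives x)%:R - alpha * (1 - pS).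
  by rewrite /M -cats1 big_cat big_seq1 addrAC subrr add0r.
have M_step h x : `|M (rcons h x) - M h| <= 1.
  move: alpha01 pS01 => /andP[? ?] /andP[? ?].
  by rewrite M_rcons ler_norml; case: arrives => /=; apply/andP; split; nra.
have M_mean h : \sum_x w x * (M (rcons h x) - M h) = 0.
  transitivity (\sum_x (w x * (arrives x)%:R - w x * (alpha * (1 - pS)))).
    by apply: eq_bigr => x _; rewrite M_rcons mulrBr.
  by rewrite sumrB arrival_mean -mulr_suml draw_law_sum mul1r subrr.
have M_prefix v n : M (prefix_at X v n) =
    \sum_(0 <= i < n) ((arrives (sample_path X v i))%:R - alpha * (1 - pS)).
  by rewrite /M /prefix_at /mkseq big_map /index_iota subn0.
have M0 : M [::] = 0 by rewrite /M big_nil.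
have := @martingale_lln R d T P A w X draw_law_ge0 draw_law_sum X_meas X_law M
  M_step M_mean M0.
apply: filterS => v; rewrite /mean_null4; under eq_fun do rewrite M_prefix.
exact.
Qed.

(** Carrying the state along makes the compensated departure count a function of the word of draws,
    the form taken by [martingale_lln]. *)
Definition compensator (h : seq A) : qstate * R :=
  foldl (fun sm x => (next_state K N sm.1 x,
    sm.2 + ((departs K N sm.1 x)%:R - pR * (active K N sm.1 x)%:R))) (s0, 0) h.

Lemma compensator_prefix (v : T) (n : nat) :
  compensator (prefix_at X v n) =
  (state K N s0 (sample_path X v) n,
   \sum_(0 <= i < n) ((departs_at K N s0 (sample_path X v) i)%:R -
     pR * (active_at K N s0 (sample_path X v) i)%:R)).
Proof.
elim: n => [|n IH]; first by rewrite big_nil.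
by rewrite /compensator /prefix_at mkseqS foldl_rcons -/(prefix_at X v n)
  -/(compensator _) IH big_nat_recr.
Qed.

Lemma departures_lln : {ae P, forall v, mean_null4 R (fun n =>
  (departs_at K N s0 (sample_path X v) n)%:R -
  pR * (active_at K N s0 (sample_path X v) n)%:R)}.
Proof.
pose M (h : seq A) := (compensator h).2.
have M_rcons h x : M (rcons h x) - M h =
    (departs K N (compensator h).1 x)%:R - pR * (active K N (compensator h).1 x)%:R.
  by rewrite /M /compensator foldl_rcons /= addrAC subrr add0r.
have M_step h x : `|M (rcons h x) - M h| <= 1.
  move: pR01 => /andP[? ?]; rewrite M_rcons ler_norml /departs.
  by case: active; case: detR => /=; apply/andP; split; lra.
have M_mean h : \sum_x w x * (M (rcons h x) - M h) = 0.
  apply: etrans (departure_compensated (compensator h).1).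
  by apply: eq_bigr => x _; rewrite M_rcons.
have := @martingale_lln R d T P A w X draw_law_ge0 draw_law_sum X_meas X_law M
  M_step M_mean erefl.
apply: filterS => v; rewrite /mean_null4.
by under eq_fun do rewrite /M compensator_prefix.
Qed.

(** Finitely many almost sure properties hold on a common path; as the limits are constants, reading
    them on that single path suffices. *)
Lemma static_policy_little (pa : R) (qd D : \bar R) : 0 < alpha ->
  is_active_fraction P K N s0 X pa -> is_mean_queue P K N s0 X qd ->
  is_mean_delay P K N s0 X D ->
  [/\ 0 <= pa, ((alpha * (1 - pS))%:E * D <= qd)%E,
      (D < +oo -> qd <= (alpha * (1 - pS))%:E * D)%E &
      forall r, qd = r%:E -> pa * pR = alpha * (1 - pS)].
Proof.
move=> alpha_gt0 hpa hqd hD.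
have lam_gt0 : 0 < alpha * (1 - pS).
  by move: pS01 => /andP[_ ?]; rewrite mulr_gt0// subr_gt0.
have PT : (0 < P [set: T])%E by rewrite probability_setT.
have proper := ae_properfilter_algebraOfSetsType PT.
have [v [v1 [v2 [v3 [v4 v5]]]]] := filter_ex (filterI arrivals_lln
  (filterI departures_lln (filterI hpa (filterI hqd hD)))).
split.
- rewrite -lee_fin; apply: cvge_ge v3; apply: nearW => t.
  by rewrite lee_fin divr_ge0// sumr_ge0.
- exact: little_le_queue lam_gt0 v1 v4 v5.
- exact: queue_le_little lam_gt0 v1 v4 v5.
- exact: departure_rate v1 v2 v3 v4.
Qed.

End StaticPolicy.

(** * The non-cooperation policy *)

Lemma time_avg_eventually0 (R : realType) (f : nat -> R) (n0 : nat) :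
  (forall n, (n0 <= n)%N -> f n = 0) -> time_avg f t @[t --> \oo] --> 0%:E.
Proof.
move=> f0; rewrite /time_avg; apply: cvg_EFin; first exact: nearW.
pose c := \sum_(0 <= n < n0) f n.
have c_cvg : c / k%:R @[k --> \oo] --> 0 by exact: cvg_inv_nat.
apply: cvg_trans c_cvg; apply: near_eq_cvg; near=> t.
have n0t : (n0 <= t)%N by near: t; exact: nbhs_infty_ge.
rewrite /= (big_cat_nat (leq0n _) n0t)//= -/c.
rewrite [X in c + X]big_nat_cond big1 ?addr0// => n /andP[/andP[n0n _] _].
exact: f0.
Unshelve. all: by end_near. Qed.

Section NonCooperation.
Variables (bmax K N : nat) (s0 : qstate) (xs : nat -> draw bmax).
Hypothesis bmax_gt0 : (0 < bmax)%N.
Hypothesis KN : (K <= N)%N.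

Definition draining_draw : draw bmax := (false, true, ord_max, true).

(* Lyapunov function of the drainage: harvesting up to K units costs at most K
   slots per packet. *)
Definition drain_time (s : qstate) : nat := (s.1 * K.+1 + (K - s.2))%N.

(** In an inactive slot the energy stays below [K <= N], so nothing is blocked and the deficit falls
    by [bmax]; an active slot saves [K.+1] for the packet and adds at most [K] of deficit. *)
Lemma drain_step (s : qstate) : (0 < s.1)%N ->
  (drain_time (next_state K N s draining_draw) < drain_time s)%N.
Proof.
case: s => [[//|q] e] _; rewrite /drain_time /next_state /departs /active /=.
by case: ifP => /=; nia.
Qed.

Lemma drained (n0 : nat) : (forall n, (n < n0)%N -> xs n = draining_draw) ->
  (drain_time s0 < n0)%N -> (state K N s0 xs n0).1 = 0%N.
Proof.
move=> xs_drain s0n0.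
have : forall n, (n <= n0)%N -> (state K N s0 xs n).1 = 0%N \/
    (drain_time (state K N s0 xs n) + n <= drain_time s0)%N.
  elim=> [|n IH] nn0; first by right; rewrite addn0.
  rewrite /= xs_drain//; have [q0|q_gt0] := posnP (state K N s0 xs n).1.
    by left; have := next_state_queue bmax K N (state K N s0 xs n) draining_draw;
      rewrite q0 /=; lia.
  have [q0|le] := IH (ltnW nn0); first by rewrite q0 in q_gt0.
  by right; have := drain_step _ q_gt0; lia.
by move=> /(_ n0 (leqnn _))[//|]; lia.
Qed.

Lemma stays_empty (n0 n : nat) : (forall n, dd_mode (xs n) = false) ->
  (state K N s0 xs n0).1 = 0%N -> (n0 <= n)%N -> (state K N s0 xs n).1 = 0%N.
Proof.
move=> no_dd q0; elim: n => [|n IH]; first by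
  rewrite leqn0 => /eqP n00; move: q0; rewrite n00.
rewrite leq_eqVlt => /predU1P[<-//|/IH qn].
have := next_state_queue bmax K N (state K N s0 xs n) (xs n).
by rewrite qn /arrives no_dd /=; lia.
Qed.

End NonCooperation.

Lemma noncooperation_limits (R : realType) (pS pR : R) (bmax K N : nat)
    (gamma : 'I_bmax.+1 -> R) (d : measure_display) (T : measurableType d)
    (P : probability T R) (s0 : qstate) (X : nat -> T -> draw bmax)
    (pa : R) (qd : \bar R) :
  0 < pS < 1 -> 0 < pR < 1 -> (0 < bmax)%N -> (K <= N)%N ->
  (forall m, 0 <= gamma m) -> \sum_(m < bmax.+1) gamma m = 1 ->
  0 < gamma ord_max -> iid_draws P 0 pS pR gamma X ->
  is_active_fraction P K N s0 X pa -> is_mean_queue P K N s0 X qd ->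
  pa = 0 /\ qd = 0%E.
Proof.
move=> pS01 pR01 bmax_gt0 KN gamma_ge0 gamma_sum gamma_max [X_meas X_law] hpa hqd.
pose A : finType := (bool * bool * 'I_bmax.+1 * bool)%type.
pose w : A -> R := draw_law 0 pS pR gamma.
(* Each draining draw lowers [drain_time] while packets remain, so this many of them empty the
   queue. *)
pose n0 := (drain_time K s0).+1.
pose h : seq A := nseq n0 (draining_draw bmax).
have w_ge0 := draw_law_ge0 R bmax 0 pS pR gamma.
have h_gt0 : 0 < \prod_(x <- h) w x.
  rewrite big_nseq; elim: {h} n0 => [|m IH] /=; rewrite ?ltr01// mulr_gt0//.
  by move: pS01 pR01 => /andP[? _] /andP[? _];
    rewrite /w /draw_law /bern /= subr0 mul1r !mulr_gt0.
have ae_w := @ae_law_neq0 R d T P A w X X_meas X_law.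
have [v vh [v1 [v2 v3]]] := @ae_meets_prefix R d T P A w X X_meas X_law h _ h_gt0
  (filterI ae_w (filterI hpa hqd)).
set xs := sample_path X v in v2 v3.
(* At [alpha = 0] a DD draw has weight zero, which [ae_law_neq0] excludes on this path. *)
have no_dd n : dd_mode (xs n) = false.
  apply: contraNF (v1 n); rewrite /xs /sample_path /w /draw_law => ->.
  by rewrite /bern /= !mul0r.
have xs_drain n : (n < n0)%N -> xs n = draining_draw bmax.
  move=> nn0; rewrite -(nth_mkseq (draining_draw bmax) xs nn0).
  by move: vh; rewrite /prefix_at size_nseq => ->; rewrite nth_nseq nn0.
have qn0 := drained bmax K N s0 xs bmax_gt0 KN n0 xs_drain (leqnn _).
have empty n : (n0 <= n)%N -> (state K N s0 xs n).1 = 0%N.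
  exact: stays_empty.
split.
- have := @time_avg_eventually0 R (fun n => (active_at K N s0 xs n)%:R) n0.
  move=> lim; apply: EFin_inj; apply: cvg_unique v2 (lim _) => // n n0n.
  by rewrite /active_at /active midslot_queue empty// /arrives no_dd.
- have := @time_avg_eventually0 R (qd_slot K N R s0 xs) n0.
  move=> lim; apply: cvg_unique v3 (lim _) => // n n0n.
  by rewrite qd_slotE empty// /arrives no_dd mul0r addr0.
Qed.

(** * Comparison of the transmission delay with [1 / pS], and the optimal policy *)

Section DelayComparison.
Variables (R : realType) (pS pR pa lam : R) (qd D : \bar R).
Hypothesis pS_gt0 : 0 < pS.
Hypothesis pR_gt0 : 0 < pR.
Hypothesis pa_ge0 : 0 <= pa.
Hypothesis lam_gt0 : 0 < lam.
Hypothesis little_le : (lam%:E * D <= qd)%E.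
Hypothesis little_ge : (D < +oo -> qd <= lam%:E * D)%E.
Hypothesis stable : forall r, qd = r%:E -> pa * pR = lam.

Let rate_gt0 : 0 < throughput pS pR pa.
Proof. by rewrite /throughput ltr_pwDl// mulr_ge0// ltW. Qed.

Let tau_fin (r : R) : qd = r%:E -> tau pS pR pa qd = ((r + 1) / (pS + lam))%:E.
Proof. by move=> qr; rewrite /tau /throughput (stable _ qr) qr. Qed.

(** [(r + 1) / (lam + pS)] is the mediant of [r / lam] and [1 / pS], so it lies on the same side of
    [1 / pS] as [r / lam]. *)
Let tau_le_cmp (r : R) : (1 / pS <= (r + 1) / (pS + lam)) = (lam / pS <= r).
Proof.
rewrite ler_pdivlMr ?addr_gt0// mul1r mulrDr mulVf ?gt_eqF//.
by rewrite [r + 1]addrC lerD2l mulrC.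
Qed.

Let tau_lt_cmp (r : R) : (1 / pS < (r + 1) / (pS + lam)) = (lam / pS < r).
Proof.
rewrite ltr_pdivlMr ?addr_gt0// mul1r mulrDr mulVf ?gt_eqF//.
by rewrite [r + 1]addrC ltrD2l mulrC.
Qed.

Lemma tau_ge : ((1 / pS)%:E <= D)%E -> ((1 / pS)%:E <= tau pS pR pa qd)%E.
Proof.
rewrite -(@lee_pmul2l _ lam%:E) ?lte_fin// => /le_trans/(_ little_le).
move: tau_fin; case: qd => [r||//] tauE.
  by rewrite (tauE r)// -EFinM !lee_fin tau_le_cmp mulrA mulr1.
by rewrite /tau addye// gt0_mulye ?leey// lte_fin invr_gt0.
Qed.

Lemma tau_gt : ((1 / pS)%:E < D)%E -> ((1 / pS)%:E < tau pS pR pa qd)%E.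
Proof.
rewrite -(@lte_pmul2l _ lam%:E) ?lte_fin// => /lt_le_trans/(_ little_le).
move: tau_fin; case: qd => [r||//] tauE.
  by rewrite (tauE r)// -EFinM !lte_fin tau_lt_cmp mulrA mulr1.
by rewrite /tau addye// gt0_mulye ?ltry// lte_fin invr_gt0.
Qed.

Lemma tau_lt : (D < (1 / pS)%:E)%E -> (tau pS pR pa qd < (1 / pS)%:E)%E.
Proof.
move=> D_lt; have qd_le := little_ge (lt_trans D_lt (ltry _)).
move: D_lt; rewrite -(@lte_pmul2l _ lam%:E) ?lte_fin//.
move=> /(le_lt_trans qd_le); rewrite -EFinM.
move: tau_fin; case: qd => [r|//|] tauE.
  by rewrite (tauE r)// !lte_fin !ltNge tau_le_cmp mulrA mulr1.
by rewrite /tau addNye gt0_mulNye ?ltNyr// lte_fin invr_gt0.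
Qed.

End DelayComparison.

(** The boundary case is stated apart: for [DR0 = 1 / pS] the policy 0 still minimizes the delay
    although the strict inequality fails. *)
Theorem lemma4 (R : realType) (pS pR : R) (bmax K N : nat)
  (gamma : 'I_bmax.+1 -> R)
  (hpS : 0 < pS < 1) (hpR : 0 < pR < 1)
  (hbmax : (1 <= bmax)%N) (hK : (bmax <= K)%N) (hN : (2 * K <= N)%N)
  (gamma_ge0 : forall m, 0 <= gamma m)
  (gamma_sum : \sum_(m < bmax.+1) gamma m = 1)
  (gamma_max : 0 < gamma ord_max)
  (gamma_mean : 0 < \sum_(m < bmax.+1) m%:R * gamma m)
  (d : measure_display) (T : measurableType d) (P : probability T R)
  (* initial state, and the draws X alpha under the static policy alpha *)
  (s0 : qstate) (hs0 : (s0.2 <= N)%N)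
  (X : R -> nat -> T -> draw bmax)
  (hX : forall alpha, 0 <= alpha <= 1 ->
     iid_draws P alpha pS pR gamma (X alpha))
  (* long-run quantities as functions of alpha *)
  (pa : R -> R) (qd DR : R -> \bar R)
  (hpa : forall alpha, 0 <= alpha <= 1 ->
     is_active_fraction P K N s0 (X alpha) (pa alpha))
  (hqd : forall alpha, 0 <= alpha <= 1 ->
     is_mean_queue P K N s0 (X alpha) (qd alpha))
  (hDR : forall alpha, 0 < alpha <= 1 ->
     is_mean_delay P K N s0 (X alpha) (DR alpha))
  (DR_incr : increasing01 DR) (DR_convex : convex01 DR) :
  let delay := fun alpha => tau pS pR (pa alpha) (qd alpha) in
  let DR0 := lim (DR alpha @[alpha --> 0^'+]) in
  (DR0 <> (1 / pS)%:E ->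
     (minimizes01 delay 0 <-> ((1 / pS)%:E < DR0)%E) /\
     (forall alphaD, minimizes01 delay alphaD ->
        (alphaD = 0 <-> ((1 / pS)%:E < DR0)%E))) /\
  (DR0 = (1 / pS)%:E -> minimizes01 delay 0).
Proof.
have /andP[pS_gt0 pS_lt1] := hpS.
have /andP[pR_gt0 _] := hpR.
have zero01 : 0 <= (0 : R) <= 1 by rewrite lexx ler01.
have KN : (K <= N)%N by apply: leq_trans hN; rewrite leq_pmull.
move=> delay DR0.
have weak01 (a : R) : 0 < a <= 1 -> 0 <= a <= 1 by move=> /andP[/ltW -> ->].
have delay0 : delay 0 = (1 / pS)%:E.
  have [pa0 qd0] := noncooperation_limits R pS pR bmax K N gamma d T P s0 (X 0)
    (pa 0) (qd 0) hpS hpR hbmax KN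
    gamma_ge0 gamma_sum gamma_max (hX 0 zero01) (hpa 0 zero01) (hqd 0 zero01).
  by rewrite /delay pa0 qd0 /tau /throughput mul0r addr0 add0e mul1e div1r.
have little (a : R) (a01 : 0 < a <= 1) : [/\ 0 <= pa a,
    ((a * (1 - pS))%:E * DR a <= qd a)%E,
    (DR a < +oo -> qd a <= (a * (1 - pS))%:E * DR a)%E &
    forall r, qd a = r%:E -> pa a * pR = a * (1 - pS)].
  have a01' := weak01 _ a01; have /andP[a_gt0 _] := a01.
  exact: (static_policy_little R bmax K N a pS pR gamma a01' hpS hpR gamma_ge0
    gamma_sum d T P s0 (X a) (hX a a01') (pa a) (qd a) (DR a) a_gt0
    (hpa a a01') (hqd a a01') (hDR a a01)).
have lam_gt0 (a : R) : 0 < a -> 0 < a * (1 - pS) by move=> a0; rewrite mulr_gt0 ?subr_gt0.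
have delay_ge (a : R) : 0 < a <= 1 -> ((1 / pS)%:E <= DR a)%E -> (delay 0%R <= delay a)%E.
  move=> a01; have /andP[a0 _] := a01; have ? := weak01 _ a01.
  rewrite delay0; have [] := little a a01 => //.
  by move=> H1 H2 H3 H4; apply: tau_ge H2 H4 => //; exact: lam_gt0.
have delay_gt (a : R) : 0 < a <= 1 -> ((1 / pS)%:E < DR a)%E -> (delay 0%R < delay a)%E.
  move=> a01; have /andP[a0 _] := a01; have ? := weak01 _ a01.
  rewrite delay0; have [] := little a a01 => //.
  by move=> H1 H2 H3 H4; apply: tau_gt H2 H4 => //; exact: lam_gt0.
have delay_lt (a : R) : 0 < a <= 1 -> (DR a < (1 / pS)%:E)%E -> (delay a < delay 0%R)%E.
  move=> a01; have /andP[a0 _] := a01; have ? := weak01 _ a01.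
  rewrite delay0; have [] := little a a01 => //.
  by move=> H1 H2 H3 H4; apply: tau_lt H3 H4 => //; exact: lam_gt0.
have DR0E : DR0 = ereal_inf [set DR a | a in `]0, 1]].
  apply: cvg_lim => //; apply: (nondecreasing_at_right_cvge (BRight 1)) => //.
    by rewrite bnd_simp.
  move=> a b; rewrite !in_itv/= => /andP[a0 _] /andP[_ b1] ab.
  exact: DR_incr.
have DR0_le (a : R) : 0 < a <= 1 -> (DR0 <= DR a)%E.
  by move=> a01; rewrite DR0E; apply: ereal_inf_lbound; exists a => //=; rewrite in_itv.
have DR0_gt : (DR0 < (1 / pS)%:E)%E -> exists2 a, 0 < a <= 1 & (delay a < delay 0%R)%E.
  rewrite DR0E => /ereal_inf_lt[_ [a /= + <-]]; rewrite in_itv/= => a01 lt.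
  by exists a => //; exact: delay_lt.
have min0 : ((1 / pS)%:E <= DR0)%E -> minimizes01 delay 0.
  move=> ge; split=> // b /andP[]; rewrite le_eqVlt => /predU1P[<- //|b0 b1].
  by apply: delay_ge; rewrite ?b0// (le_trans ge)// DR0_le ?b0.
split; last by move=> DR0_eq; apply: min0; rewrite DR0_eq.
move=> /eqP DR0_neq.
(* With equality excluded, failure of the strict inequality puts the infimum [DR0] below [1 / pS],
   so some policy [a] beats 0. *)
have not_gt : ~ ((1 / pS)%:E < DR0)%E ->
    exists2 a, 0 < a <= 1 & (delay a < delay 0%R)%E.
  by move=> /negP; rewrite -leNgt le_eqVlt (negPf DR0_neq) => /DR0_gt.
have lt_of_min : minimizes01 delay 0 -> ((1 / pS)%:E < DR0)%E.
  move=> [_ min]; apply: contrapT => /not_gt[a /weak01 a01].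
  by rewrite ltNge min.
split; first by split=> // /ltW.
move=> a a_min; split=> [a0|gt]; first by apply: lt_of_min; rewrite -a0.
(* A minimizer [a > 0] would satisfy [DR a >= DR0 > 1 / pS], hence have a larger delay than 0. *)
have [/andP[]] := a_min; rewrite le_eqVlt => /predU1P[//|a0 a1] /(_ 0 zero01).
by rewrite leNgt delay_gt ?a0// (lt_le_trans gt)// DR0_le ?a0.
Qed.
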